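(* Let $\gamma$ be a quasilocal POS on a countable color space $E$. If there exists a dust-rate matrix $\alpha$ for $\gamma$ such that $\Gamma:=\sup_{y\in S}\sum_{x\le y}\alpha_{y,x}<1$, then $|\mathcal G(\gamma)|\le1$.
   Context: $(S,\le)$ is a countable partially ordered set. For $x\in S$ write $x_-=\{y\in S:y<x\}$, $x_+=\{y\in S:y>x\}$. For $\Upsilon\subset S$: $\max(\Upsilon)=\{x\in\Upsilon: y\notin\Upsilon\text{ for all }y>x\}$, $\min(\Upsilon)=\{x\in\Upsilon: y\notin\Upsilon\text{ for all }y<x\}$, the past $\Upsilon_-=\{x\in S\setminus\Upsilon:\exists y\in\Upsilon,\ x<y\}$, the future $\Upsilon_+=\{x\in S\setminus\Upsilon:\exists y\in\Upsilon,\ x>y\}$, and the outer time $\Upsilon^*=\{x\in S: x\text{ is comparable with no }y\in\Upsilon\}$. Standing assumptions: for every $x\in S$, $\max(x_-)$ and $\min(x_+)$ are finite, every $y<x$ satisfies $y\le y_0<x$ for some $y_0\in\max(x_-)$, every $z>x$ satisfies $z\ge z_0>x$ for some $z_0\in\min(x_+)$; and $S$ has no minimal element. A finite set $\Lambda\subset S$ is a time box if $\Lambda_-\cap\Lambda_+=\emptyset$. $\Omega=E^S$ with product $\sigma$-algebra $\mathcal F$ ($E$ with its discrete $\sigma$-algebra); $\mathcal F_\Upsilon$ is generated by coordinates in $\Upsilon$; local means $\mathcal F_\Delta$-measurable for some finite $\Delta$. A proper oriented kernel on a time box $\Lambda$ is a map $\gamma_\Lambda:\mathcal F_{S\setminus\Lambda_+}\times\Omega\to[0,1]$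 such that (a) $\gamma_\Lambda(\cdot,\omega)$ is a probability measure; (b) $\gamma_\Lambda(A,\cdot)$ is $\mathcal F_{\Lambda_-\cup\Lambda^*}$-measurable for $A\in\mathcal F_{S\setminus\Lambda_+}$; (c) $\gamma_\Lambda(A,\cdot)$ is $\mathcal F_{\Lambda_-}$-measurable for $A\in\mathcal F_\Lambda$; (d) $\gamma_\Lambda(B,\omega)=\mathbf 1_B(\omega)$ for $B\in\mathcal F_{\Lambda_-\cup\Lambda^*}$. Write $\gamma_\Lambda f(\omega)=\gamma_\Lambda(f\mid\omega)=\int f\,d\gamma_\Lambda(\cdot,\omega)$; compositions $(\gamma_\Delta\gamma_\Lambda)(f\mid\omega)=\int\gamma_\Lambda(f\mid\sigma)\gamma_\Delta(d\sigma,\omega)$, $(\mu\gamma_\Lambda)(f)=\int\gamma_\Lambda(f\mid\sigma)\mu(d\sigma)$. A POS is a family $\gamma=(\gamma_\Lambda)$ of proper oriented kernels indexed by all time boxes with $\gamma_\Delta\gamma_\Lambda=\gamma_\Delta$ on $\mathcal F_{S\setminus\Lambda_+}$ whenever $\Lambda\subset\Delta$; $\gamma_y=\gamma_{\{y\}}$. $\mathcal G(\gamma)$ is the set of probability measures $\mu$ with $\mu\gamma_\Lambda=\mu$ on $\mathcal F_{S\setminus\Lambda_+}$ for all time boxes. A function $f$ is quasilocal if for every $\varepsilon>0$ there is a finite $\Lambda$ with $\sup_{\omega_\Lambda=\sigma_\Lambda}|f(\omega)-f(\sigma)|<\varepsilon$; the POS is quasilocal if $\gamma_\Lambda(A,\cdot)$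 is quasilocal for every time box $\Lambda$ and local event $A\in\mathcal F_{S\setminus\Lambda_+}$. For $\xi,\eta\in\Omega$ and $x\in S$, $\xi\overset{x}{=}\eta$ means $\xi_z=\eta_z$ for all $z\ne x$; the oscillation of $f$ at $x$ is $\delta_x(f)=\sup_{\xi\overset{x}{=}\eta}|f(\xi)-f(\eta)|$. A dust-rate matrix is a family $(\alpha_{y,x})_{x\le y}$ of nonnegative reals with $\alpha_{y,y}=0$ for all $y$ and $\delta_x(\gamma_y f)\le\delta_y(f)\,\alpha_{y,x}$ for all $y\in S$, $x\in y_-$ and all bounded $\mathcal F_{\{y\}}$-measurable $f$. *)

(* Defs.v *)
From HB Require Import structures.
From mathcomp Require Import all_boot all_order all_algebra.
From mathcomp Require Import all_classical all_reals all_analysis.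
Set Implicit Arguments. Unset Strict Implicit. Unset Printing Implicit Defensive.
Import Order.TTheory GRing.Theory Num.Theory.
Local Open Scope classical_set_scope.
Local Open Scope ring_scope.

Section Defs.
Context {d : Order.disp_t} {S : porderType d} {E : pointedType}.
Local Notation Omega := (S -> E).

Definition past_pt (x : S) : set S := [set y | (y < x)%O].
Definition future_pt (x : S) : set S := [set y | (x < y)%O].
Definition maxset (U : set S) : set S :=
  [set x | U x /\ forall y, (x < y)%O -> ~ U y].
Definition minset (U : set S) : set S :=
  [set x | U x /\ forall y, (y < x)%O -> ~ U y].
Definition past (U : set S) : set S := [set x | ~ U x /\ exists2 y, U y & (x < y)%O].
Definition future (U : set S) : set S := [set x | ~ U x /\ exists2 y, U y & (y < x)%O].
Definition outer (U : set S) : set S := [set x | forall y, U y -> ~ (x >=< y)%O].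

Definition is_time_box (L : set S) : Prop := finite_set L /\ past L `&` future L = set0.

Definition coord_gen (U : set S) : set (set Omega) :=
  [set A | exists x e, U x /\ A = (fun w : Omega => w x) @^-1` [set e]].
Definition F (U : set S) : set (set Omega) := <<s coord_gen U >>.
Definition OmegaT (U : set S) := g_sigma_algebraType (coord_gen U).

Definition measurable_wrt {R : realType} (U : set S) (f : Omega -> R) : Prop :=
  forall B : set R, measurable B -> F U (f @^-1` B).
Definition is_local (A : set Omega) : Prop := exists D : set S, finite_set D /\ F D A.
Definition quasilocal {R : realType} (f : Omega -> R) : Prop :=
  forall eps : R, 0 < eps -> exists L : set S, finite_set L /\
    forall w s : Omega, (forall z, L z -> w z = s z) -> `|f w - f s| < eps.
Definition eq_off (x : S) (w s : Omega) : Prop := forall z, z <> x -> w z = s z.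
Definition osc {R : realType} (x : S) (f : Omega -> R) : \bar R :=
  ereal_sup [set r | exists w s : Omega, eq_off x w s /\ r = (`|f w - f s|)%:E].

Section Kernels.
Variable R : realType.
Definition kfamily := forall L : set S, Omega -> probability (OmegaT (~` future L)) R.
Variable g : kfamily.

Definition proper_oriented_kernel (L : set S) : Prop :=
  (forall A, F (~` future L) A ->
     measurable_wrt (past L `|` outer L) (fun w => fine (g L w A))) /\
  (forall A, F L A -> measurable_wrt (past L) (fun w => fine (g L w A))) /\
  (forall B w, F (past L `|` outer L) B -> g L w B = (\1_B w)%:E).

Definition is_POS : Prop :=
  (forall L, is_time_box L -> proper_oriented_kernel L) /\
  (forall L D, is_time_box L -> is_time_box D -> L `<=` D ->
     forall A w, F (~` future L) A -> F (~` future D) A ->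
       measurable_wrt (~` future D) (fun s => fine (g L s A)) ->
       (\int[g D w]_s g L s A = g D w A)%E).

Definition quasilocal_POS : Prop := is_POS /\
  forall L A, is_time_box L -> F (~` future L) A -> is_local A ->
    quasilocal (fun w => fine (g L w A)).

Definition is_dust_rate (alpha : S -> S -> R) : Prop :=
  (forall x y, (x <= y)%O -> 0 <= alpha y x) /\
  (forall y, alpha y y = 0) /\
  (forall y x (f : Omega -> R), past_pt y x -> measurable_wrt [set y] f ->
     (exists M : R, forall w, `|f w| <= M) ->
     (osc x (fun w => fine (\int[g [set y] w]_s (f s)%:E)) <= osc y f * (alpha y x)%:E)%E).

Definition dust_Gamma (alpha : S -> S -> R) : \bar R :=
  ereal_sup [set (\esum_(x in [set x | (x <= y)%O]) (alpha y x)%:E)%E | y in setT].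

Definition in_Gibbs (mu : probability (OmegaT setT) R) : Prop :=
  forall L, is_time_box L -> forall A, F (~` future L) A ->
    mu A = (\int[mu]_s g L s A)%E.
End Kernels.

Definition standing_assumptions : Prop :=
  countable [set: S] /\
  (forall x, finite_set (maxset (past_pt x)) /\ finite_set (minset (future_pt x))) /\
  (forall x y, (y < x)%O -> exists2 y0, maxset (past_pt x) y0 & (y <= y0)%O) /\
  (forall x z, (x < z)%O -> exists2 z0, minset (future_pt x) z0 & (z0 <= z)%O) /\
  (forall x : S, exists y : S, (y < x)%O).
End Defs.

(* Main.v *)
Require Import Defs.
From HB Require Import structures.
From mathcomp Require Import all_boot all_order all_algebra.
From mathcomp Require Import all_classical all_reals all_analysis.
From mathcomp Require Import measurable_realfun zify lra ring.
Set Implicit Arguments. Unset Strict Implicit. Unset Printing Implicit Defensive.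
Import Order.TTheory GRing.Theory Num.Theory.
Local Open Scope classical_set_scope.
Local Open Scope ring_scope.

(** Dobrushin's dusting argument. A local function [f] carries the dust [delta_x f]
    at each site [x] of its finite support. If [y] is maximal in the support,
    replacing [f] by [gamma_y f] does not change its integral under a Gibbs measure,
    removes the dust at [y], and spreads at most [alpha_{y,x} delta_y f] to the sites
    [x < y]: the moved dust shrinks by the factor [Gamma]. Intervals of [S] may be
    infinite, so the sites cannot simply be swept downwards; instead, by
    quasilocality, [gamma_y f] is approximated by a local function after each step.
    Dust that has been moved [n] times is simply dropped, at the cost of its total
    mass, which is at most [Gamma^n] times the initial one; this makes the procedure
    finite, and letting [n] tend to infinity shows that two Gibbs measures agree on
    all local functions. *)

(** Coordinates of higher index dominate, and those below [j] may grow arbitrarily. The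
    lexicographic induction on the first [K] coordinates is nested inside a strong induction on the
    top one, [c s K]. *)
Lemma lexicographic_ind (T : Type) (c : T -> nat -> nat) (K : nat) (P : T -> Prop) :
  (forall s, (forall s' j, (j < K)%N -> (c s' j < c s j)%N ->
      (forall i, (j < i < K)%N -> c s' i = c s i) -> P s') -> P s) ->
  forall s, P s.
Proof.
elim: K P => [|K IHK] P H s; first by apply: H.
move: {2}(c s K).+1 (ltnSn (c s K)) => n.
elim: n s => // n IHn s; rewrite ltnS.
move: s; apply: (IHK (fun s => (c s K <= n)%N -> P s)) => s IHs sn.
apply: H => s' j; rewrite ltnS leq_eqVlt => /predU1P[->|jK] lt_c eq_c.
  by apply: IHn; exact: leq_trans lt_c sn.
apply: (IHs s' j) => // [i /andP[ji iK]|].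
  by apply: eq_c; rewrite ji ltnW.
by rewrite eq_c ?jK//= ltnSn.
Qed.

(** * Integrals of bounded and of finitely valued functions against a probability *)

Section Probability.
Context {d : measure_display} {T : measurableType d} {R : realType}.
Variable P : probability T R.
Implicit Types f g : T -> R.

Lemma bounded_integrable f (M : R) : measurable_fun setT f ->
  (forall w, `|f w| <= M) -> P.-integrable setT (EFin \o f).
Proof.
move=> mf fM; apply: measurable_bounded_integrable => //.
  by apply: (le_lt_trans (probability_le1 P measurableT)); rewrite ltry.
by exists M; split; [exact: num_real|move=> r Mr w _ /=; exact: le_trans (fM w) (ltW Mr)].
Qed.

Lemma Rintegral_probability_cst (r : R) : \int[P]_w r = r.
Proof.
rewrite Rintegral_cst// -[RHS]mulr1; congr (_ * _).
by have /(congr1 fine) /= := probability_setT P.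
Qed.

Lemma Rintegral_dist f g (e : R) :
  P.-integrable setT (EFin \o f) -> P.-integrable setT (EFin \o g) ->
  (forall w, `|f w - g w| <= e) ->
  `|\int[P]_w f w - \int[P]_w g w| <= e.
Proof.
move=> intf intg fge.
have intfg : P.-integrable setT (EFin \o (fun w => f w - g w)).
  exact: (integrableB measurableT intf intg).
rewrite -RintegralB//; apply: le_trans (le_normr_Rintegral _ intfg) _ => //.
rewrite -[leRHS]Rintegral_probability_cst.
apply: le_Rintegral => //; first exact: integrable_norm.
apply: (@bounded_integrable _ `|e|) => //.
Qed.

Lemma finite_range_sum f (s : seq R) (w : T) : uniq s -> f w \in s ->
  f w = \sum_(c <- s) c * \1_(f @^-1` [set c]) w.
Proof.
move=> us fs; rewrite (bigD1_seq (f w))//= indicE mem_set// mulr1.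
rewrite big1 ?addr0// => c cfw; rewrite indicE memNset ?mulr0//=.
by move=> /esym/eqP; rewrite (negbTE cfw).
Qed.

Lemma finite_range_measurable f (s : seq R) : uniq s -> (forall w, f w \in s) ->
  (forall c, measurable (f @^-1` [set c])) -> measurable_fun setT f.
Proof.
move=> us fs mf.
rewrite (_ : f = fun w => \sum_(c <- s) c * \1_(f @^-1` [set c]) w); last first.
  by apply/funext => w; exact: finite_range_sum.
by apply: measurable_sum => c; apply: measurable_funM => //; exact: measurable_indic.
Qed.

Lemma finite_range_bounded (f : T -> R) (s : seq R) : (forall w, f w \in s) ->
  exists M : R, forall w, `|f w| <= M.
Proof.
move=> fs; exists (\sum_(c <- s) `|c|) => w; rewrite (big_rem (f w))//= lerDl.
by apply: sumr_ge0.
Qed.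

Lemma finite_range_integrable f (s : seq R) : uniq s -> (forall w, f w \in s) ->
  (forall c, measurable (f @^-1` [set c])) -> P.-integrable setT (EFin \o f).
Proof.
move=> us fs mf; have [M fM] := finite_range_bounded fs.
by apply: (@bounded_integrable _ M) => //; exact: (finite_range_measurable us fs mf).
Qed.

Lemma integrable_Rsum (I : Type) (s : seq I) (h : I -> T -> R) :
  (forall i, P.-integrable setT (EFin \o h i)) ->
  P.-integrable setT (EFin \o fun w => \sum_(i <- s) h i w).
Proof.
move=> ih; rewrite (_ : _ \o _ = fun w => (\sum_(j <- s) (EFin \o h j) w)%E).
  exact: integrable_sum.
by apply/funext => w /=; rewrite sumEFin.
Qed.

Lemma Rintegral_sum (I : Type) (s : seq I) (h : I -> T -> R) :
  (forall i, P.-integrable setT (EFin \o h i)) ->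
  \int[P]_w (\sum_(i <- s) h i w) = \sum_(i <- s) \int[P]_w h i w.
Proof.
move=> ih; elim: s => [|i s IHs].
  by under eq_Rintegral do rewrite big_nil; rewrite Rintegral_cst// mul0r big_nil.
under eq_Rintegral do rewrite big_cons.
by rewrite big_cons -IHs RintegralD//; exact: integrable_Rsum.
Qed.

(** Reduces integrals to probabilities of level sets, so that properties of kernels on events carry
    over to functions. *)
Lemma finite_range_Rintegral f (s : seq R) : uniq s -> (forall w, f w \in s) ->
  (forall c, measurable (f @^-1` [set c])) ->
  \int[P]_w f w = \sum_(c <- s) c * fine (P (f @^-1` [set c])).
Proof.
move=> us fs mf; under eq_Rintegral do rewrite (@finite_range_sum f s)//.
have iI c : P.-integrable setT (EFin \o \1_(f @^-1` [set c])).
  apply: (@bounded_integrable _ 1); first exact: measurable_indic.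
  by move=> w; rewrite indicE; case: (_ \in _); rewrite ?normr1 ?normr0.
rewrite Rintegral_sum; last first.
  by move=> c; exact: (integrableZl measurableT c (iI c)).
apply: eq_bigr => c _; rewrite RintegralZl// /Rintegral.
by rewrite integral_indic// setIT.
Qed.

(** The complement of [B] is a null set. In the application, [B] fixes the coordinates that a proper
    kernel copies from its boundary condition. *)
Lemma probability_eq_on (A A' B : set T) : measurable A -> measurable A' ->
  measurable B -> P B = 1%E -> A `&` B = A' `&` B -> P A = P A'.
Proof.
move=> mA mA' mB PB AA'.
have PCB : P (~` B) = 0%E by rewrite probability_setC// PB subee.
have E C : measurable C -> P C = P (C `&` B).
  move=> mC; have mCB : measurable (C `\` B) by exact: measurableD.
  have mCIB : measurable (C `&` B) by exact: measurableI.
  have CB0 : P (C `\` B) = 0%E.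
    apply: (@subset_measure0 _ _ _ P _ (~` B)) => //; exact: measurableC.
  have := measureU P mCIB mCB; rewrite setUIDK [X in (_ + X)%E]CB0 adde0; apply.
  by apply/seteqP; split => w //= [[_ ?] [_ ?]].
by rewrite E// AA' -E.
Qed.

End Probability.

(** * Functions and events that depend on given coordinates *)

Section Configurations.
Context {d : Order.disp_t} {S : porderType d} {E : pointedType}.
Local Notation Omega := (S -> E).
Implicit Types (U V : set S) (A : set Omega) (w : Omega).

Definition upd w (y : S) (e : E) : Omega := fun z => if z == y then e else w z.

Definition agree U w w' := forall z, U z -> w z = w' z.

(** Dependence on coordinates, free of measurability; events are the case of [Prop]-valued
    functions. For finite [U] and countable [E] it characterises the events of [F U]. *)
Definition determined {T : Type} U (f : Omega -> T) :=
  forall w w', agree U w w' -> f w = f w'.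

Lemma sub_determined {T : Type} U V (f : Omega -> T) :
  U `<=` V -> determined U f -> determined V f.
Proof. by move=> UV fU w w' ww'; apply: fU => z /UV; exact: ww'. Qed.

Lemma sub_F U V : U `<=` V -> @F d S E U `<=` F V.
Proof.
move=> UV; apply: sub_sigma_algebra2 => A [x [e [Ux ->]]].
by exists x, e; split => //; exact: UV.
Qed.

(** The events determined by [U] form a sigma-algebra containing the generators of [F U]. *)
Lemma F_determined U A : F U A -> determined U A.
Proof.
move: A; apply: smallest_sub.
  split => [//|A UA w w' ww'|G UG w w' ww'].
  - by rewrite /setD /=; congr (_ /\ ~ _); exact: UA.
  - by apply/propext; split => -[n _ Gw]; exists n => //;
      rewrite ?(UG n _ _ ww')// -(UG n _ _ ww').
by move=> A [x [e [Ux ->]]] w w' ww' /=; rewrite ww'.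
Qed.

Lemma measurable_wrt_determined {R : realType} U (f : Omega -> R) :
  measurable_wrt U f -> determined U f.
Proof.
move=> mf w w' ww'.
have /F_determined/(_ _ _ ww') : F U (f @^-1` [set f w]) by exact: mf.
by rewrite /preimage/= => ff; apply/esym; rewrite -ff.
Qed.

Hypothesis countE : countable [set: E].

(** Induction on [D]: split [A] by the colour [e] at the first site [x]. There are countably many
    pieces, and the section of [A] at each colour is determined by the other sites. *)
Lemma determined_F (D : seq S) U A :
  [set` D] `<=` U -> determined [set` D] A -> F U A.
Proof.
elim: D A => [|x D IHD] A DU detA.
  have [A0|A0] := pselect (A (fun=> point)).
    rewrite (_ : A = setT); first exact: (@measurableT _ (OmegaT U)).
    by apply/seteqP; split => // w _; rewrite (detA w (fun=> point)).
  rewrite (_ : A = set0); first exact: (@measurable0 _ (OmegaT U)).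
  by apply/seteqP; split => // w; rewrite (detA w (fun=> point)).
have -> : A = \bigcup_e ((fun w => w x) @^-1` [set e] `&` [set w | A (upd w x e)]).
  apply/seteqP; split => w.
    move=> Aw; exists (w x) => //; split => //=.
    by rewrite (detA _ w)// => z _; rewrite /upd; case: eqP => // ->.
  move=> [e _ [/= <-]]; rewrite (detA _ w)// => z _.
  by rewrite /upd; case: eqP => // ->.
apply: (@countable_bigcupT_measurable _ (OmegaT U)) => // e.
apply: (@measurableI _ (OmegaT U)).
  apply: sub_sigma_algebra; exists x, e; split => //.
  by apply: DU => /=; rewrite inE eqxx.
apply: IHD => [z zD|w w' ww'].
  by apply: DU => /=; rewrite inE zD orbT.
apply: detA => z; rewrite /= inE /upd; case: eqP => //= _; exact: ww'.
Qed.

Lemma level_set_F {R : realType} (D : seq S) U (f : Omega -> R) (c : R) :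
  [set` D] `<=` U -> determined [set` D] f -> F U (f @^-1` [set c]).
Proof.
move=> DU detf; apply: (determined_F DU) => w w' ww'.
by rewrite /preimage /= (detf w w').
Qed.

(** For such a local function the integral under a kernel is a finite combination of probabilities
    of local events, to which quasilocality and the Gibbs property apply directly. *)
Definition finite_range {R : realType} (f : Omega -> R) :=
  exists2 s : seq R, uniq s & forall w, f w \in s.

Lemma local_integrable {R : realType} U (P : probability (@OmegaT d S E U) R)
    (D : seq S) (f : Omega -> R) :
  [set` D] `<=` U -> determined [set` D] f -> finite_range f ->
  P.-integrable setT (EFin \o f).
Proof.
move=> DU detf [s us fs].
apply: (@finite_range_integrable _ (OmegaT U) _ P f s us fs) => c.
exact: (level_set_F c DU detf).
Qed.

Lemma local_Rintegral {R : realType} U (P : probability (@OmegaT d S E U) R)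
    (D : seq S) (f : Omega -> R) (s : seq R) :
  [set` D] `<=` U -> determined [set` D] f -> uniq s -> (forall w, f w \in s) ->
  \int[P]_w f w = \sum_(c <- s) c * fine (P (f @^-1` [set c])).
Proof.
move=> DU detf us fs.
apply: (@finite_range_Rintegral _ (OmegaT U)) => // c.
exact: (level_set_F c DU detf).
Qed.

End Configurations.

(** * The kernel of a single site acting on local functions *)

Section SingleSite.
Context {d : Order.disp_t} {S : porderType d} {E : pointedType} {R : realType}.
Local Notation Omega := (S -> E).
Hypothesis countE : countable [set: E].
Variable g : @kfamily d S E R.

Lemma time_box1 (y : S) : is_time_box [set y].
Proof.
split; first exact: finite_set1.
apply/seteqP; split => // x [[_ [_ -> xy]] [_ [_ -> yx]]].
by have := lt_trans xy yx; rewrite ltxx.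
Qed.

Lemma not_future1 (y x : S) : (~` future [set y]) x <-> ~ (y < x)%O.
Proof.
split=> [nf yx|nyx [_ [_ -> ]]//].
by apply: nf; split; [move=> xy; move: yx; rewrite xy ltxx|exists y].
Qed.

Lemma not_future1_past_outer (y x : S) : x <> y -> ~ (y < x)%O ->
  (past [set y] `|` outer [set y]) x.
Proof.
move=> xy nyx; have [lt_xy|nlt_xy] := boolP (x < y)%O; [left|right].
  by split => //; exists y.
move=> _ ->; apply/negP; rewrite comparable_sym /Order.comparable !le_eqVlt.
move/negP : nyx => /negbTE ->; rewrite (negbTE nlt_xy) !orbF eq_sym orbb.
exact/eqP.
Qed.

Definition gam (y : S) (f : Omega -> R) (w : Omega) : R := \int[g [set y] w]_s f s.

Section Site.
Variable y : S.
Hypothesis propy : proper_oriented_kernel g [set y].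

Let yfut : [set` [:: y]] `<=` ~` future [set y].
Proof. by move=> x /=; rewrite inE => /eqP ->; apply/not_future1; rewrite ltxx. Qed.

Section Fun.
Variables (D : seq S) (f : Omega -> R).
Hypothesis Dy : forall x, x \in D -> ~ (y < x)%O.
Hypothesis detf : determined [set` D] f.

Let Dfut : [set` D] `<=` ~` future [set y].
Proof. by move=> x xD; apply/not_future1; exact: Dy. Qed.

Lemma gam_sum (s : seq R) : uniq s -> (forall w, f w \in s) ->
  gam y f = fun w => \sum_(c <- s) c * fine (g [set y] w (f @^-1` [set c])).
Proof.
by move=> us fs; apply/funext => w; exact: (local_Rintegral countE _ Dfut detf us fs).
Qed.

Lemma frozen_determined (w : Omega) :
  determined [set` [:: y]] (fun s : Omega => f (upd w y (s y))).
Proof. by move=> s s' ss'; rewrite ss'//= inE. Qed.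

(* By properness, the coordinates of D other than y are almost surely those of w. *)
Lemma gam_frozen (w : Omega) : finite_range f ->
  gam y f w = gam y (fun s => f (upd w y (s y))) w.
Proof.
move=> [s us fs]; rewrite /gam (local_Rintegral countE _ Dfut detf us fs).
rewrite (local_Rintegral countE _ yfut (frozen_determined w) us)//.
apply: eq_bigr => c _; congr (_ * fine _).
pose B : set Omega := agree [set x | x \in D /\ x <> y] w.
have FB V : (forall x, x \in D -> x <> y -> V x) -> F V B.
  move=> DV; apply: (determined_F countE (D := [seq x <- D | x != y])).
    by move=> x /=; rewrite mem_filter => /andP[/eqP xy xD]; exact: DV.
  move=> s1 s2 s12; apply/propext; split => Bs z [zD zy]; rewrite (Bs z)//.
    by apply: s12; rewrite /= mem_filter zD andbT; exact/eqP.
  by apply/esym/s12; rewrite /= mem_filter zD andbT; exact/eqP.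
apply: (@probability_eq_on _ _ _ (g [set y] w) _ _ B).
- exact: (level_set_F countE c Dfut detf).
- exact: (level_set_F countE c yfut (frozen_determined w)).
- by apply: FB => x xD _; exact: Dfut.
- rewrite (propy.2.2 B w); first by rewrite indicE mem_set.
  by apply: FB => x xD xy; apply: not_future1_past_outer => //; exact: Dy.
- have fE s' : B s' -> f s' = f (upd w y (s' y)).
    move=> Bs; apply: detf => z zD; rewrite /upd; case: eqP => [->//|zy].
    by rewrite (Bs z).
  by apply/seteqP; split => s' [] /= fc Bs; split => //=; move: fc; rewrite (fE s' Bs).
Qed.

Lemma gam_bounded (M : R) : finite_range f -> (forall w, `|f w| <= M) ->
  forall w, `|gam y f w| <= M.
Proof.
move=> rf fM w; have intf := local_integrable countE (g [set y] w) Dfut detf rf.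
have := @Rintegral_dist _ _ _ (g [set y] w) f (fun=> 0) M intf.
rewrite Rintegral_cst// mul0r subr0; apply.
  by apply: (@bounded_integrable _ _ _ _ _ 0) => // w'; rewrite normr0.
by move=> w'; rewrite subr0.
Qed.

Lemma gam_osc (x : S) (w w' : Omega) (a b : R) : finite_range f ->
  eq_off x w w' ->
  (forall s s', eq_off x s s' -> `|f s - f s'| <= a) ->
  `|gam y (fun s => f (upd w y (s y))) w - gam y (fun s => f (upd w y (s y))) w'| <= b ->
  `|gam y f w - gam y f w'| <= a + b.
Proof.
move=> rf ww' fa fb; have [s us fs] := rf.
rewrite (gam_frozen w)// (gam_frozen w')//.
set u := gam y _ w; set v := gam y _ w'.
set t := gam y (fun s => f (upd w y (s y))) w'.
rewrite (_ : u - v = (t - v) + (u - t)); last by ring.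
apply: le_trans (ler_normD _ _) _; apply: lerD => //.
apply: (@Rintegral_dist _ _ _ (g [set y] w')).
- by apply: (local_integrable countE _ yfut); [exact: frozen_determined|exists s].
- by apply: (local_integrable countE _ yfut); [exact: frozen_determined|exists s].
- move=> s'; apply: fa => z zx; rewrite /upd; case: eqP => // _; exact: ww'.
Qed.

Lemma gam_frozen_determined (w : Omega) : finite_range f ->
  determined (past [set y]) (gam y (fun s => f (upd w y (s y)))).
Proof.
move=> [s us fs] w1 w2 w12.
rewrite /gam !(local_Rintegral countE _ yfut (frozen_determined w) us)//.
apply: eq_bigr => c _; congr (_ * _).
have yy : [set` [:: y]] `<=` [set y] by move=> z /=; rewrite inE => /eqP.
have mA := propy.2.1 _ (level_set_F countE c yy (frozen_determined w)).
exact: (measurable_wrt_determined mA w12).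
Qed.

(** The dust at [y] disappears: both configurations freeze [f] to the same function, whose integral
    depends on the past of [y] only. *)
Lemma gam_indep (w w' : Omega) : finite_range f -> eq_off y w w' ->
  gam y f w = gam y f w'.
Proof.
move=> rf ww'; rewrite (gam_frozen w)// (gam_frozen w')//.
rewrite (@gam_frozen_determined w rf w w').
  congr (gam y _ w'); apply/funext => s; congr f.
  by apply/funext => z; rewrite /upd; case: eqP => // zy; exact: ww'.
by move=> z [zy _]; exact: ww'.
Qed.

Lemma gam_quasilocal : finite_range f ->
  (forall A, F (~` future [set y]) A -> is_local A ->
    quasilocal (fun w => fine (g [set y] w A))) ->
  quasilocal (gam y f).
Proof.
move=> [s us fs] ql; rewrite (gam_sum us fs).
have {us fs} : forall c, quasilocal (fun w => fine (g [set y] w (f @^-1` [set c]))).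
  move=> c; apply: ql; first exact: (level_set_F countE c Dfut detf).
  exists [set` D]; split; first exact: finite_seq.
  exact: (level_set_F countE c _ detf).
elim: s => [|c s IHs] qlc e e0.
  by exists set0; split => // w w' _; rewrite !big_nil subrr normr0.
have [L1 [finL1 HL1]] := IHs qlc _ (divr_gt0 e0 (ltr0n _ 2)).
(* The added 1 covers the value [c = 0]. *)
have e1 : 0 < e / 2 / (`|c| + 1) by rewrite divr_gt0// ?divr_gt0// ltr_wpDl.
have [L2 [finL2 HL2]] := qlc c _ e1.
exists (L1 `|` L2); split; first by rewrite finite_setU.
move=> w w' ww'; rewrite !big_cons.
have H1 := HL1 w w' (fun z Lz => ww' z (or_introl Lz)).
have H2 := HL2 w w' (fun z Lz => ww' z (or_intror Lz)).
set u := fine _ in H2 *; set v := fine _ in H2 *.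
set p := \sum_(_ <- _) _ in H1 *; set q := \sum_(_ <- _) _ in H1 *.
rewrite (_ : _ - _ = c * (u - v) + (p - q)); last by ring.
apply: le_lt_trans (ler_normD _ _) _; rewrite [ltRHS](splitr e).
apply: ler_ltD => //; rewrite normrM.
apply: (@le_trans _ _ ((`|c| + 1) * (e / 2 / (`|c| + 1)))).
  by apply: ler_pM => //; [rewrite lerDl|exact: ltW].
by rewrite mulrC divfK// gt_eqF// ltr_wpDl.
Qed.

(** The Gibbs property concerns events; summing over the values of [f] transfers it to functions. *)
Lemma gibbs_gam (mu : probability (@OmegaT d S E setT) R) : in_Gibbs g mu ->
  finite_range f ->
  mu.-integrable setT (EFin \o gam y f) /\ \int[mu]_w gam y f w = \int[mu]_w f w.
Proof.
move=> gmu [s us fs]; rewrite (gam_sum us fs).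
have DT : [set` D] `<=` setT by [].
rewrite (local_Rintegral countE _ DT detf us fs).
have FA c := level_set_F countE c Dfut detf.
have iA c : mu.-integrable setT (EFin \o fun w => fine (g [set y] w (f @^-1` [set c]))).
  apply: (@bounded_integrable _ (OmegaT setT) _ mu _ 1).
    move=> _ B mB; rewrite setTI.
    by apply: (sub_F (U := past [set y] `|` outer [set y])) => //; exact: propy.1.
  move=> w; rewrite ger0_norm ?fine_ge0//.
  rewrite -lee_fin fineK ?fin_num_measure//; last exact: FA.
  by apply: probability_le1; exact: FA.
have icA c : mu.-integrable setT
    (EFin \o fun w => c * fine (g [set y] w (f @^-1` [set c]))).
  exact: (integrableZl (@measurableT _ (OmegaT setT)) c (iA c)).
split; first exact: (integrable_Rsum s icA).
rewrite Rintegral_sum//; apply: eq_bigr => c _.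
rewrite RintegralZl//; congr (_ * _).
rewrite (gmu [set y] (time_box1 y) _ (FA c)) /Rintegral; congr fine.
by apply: eq_integral => w _; rewrite /= fineK// fin_num_measure//; exact: FA.
Qed.

End Fun.
End Site.
End SingleSite.

(** * Rounding bounded functions to finitely many values *)

Section Rounding.
Context {R : realType}.

Definition round_to (e t : R) : R := e * (Num.floor (t / e))%:~R.

Lemma round_to_dist (e t : R) : 0 < e -> `|round_to e t - t| <= e.
Proof.
move=> e0; rewrite -{2}(divfK (lt0r_neq0 e0) t) /round_to mulrC -mulrBl normrM.
rewrite (gtr0_norm e0) ler_piMl ?(ltW e0)//.
rewrite distrC ger0_norm; last by rewrite subr_ge0 Num.Theory.floor_le.
by rewrite lerBlDl ltW// -[ltRHS]intrD1 floorD1_gt.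
Qed.

Lemma finite_range_round {d : Order.disp_t} {S : porderType d} {E : pointedType}
    (e M : R) (f : (S -> E) -> R) : 0 < e ->
  (forall w, `|f w| <= M) -> finite_range (fun w => round_to e (f w)).
Proof.
move=> e0 fM; pose N := Num.bound (M / e).
(* Since [N] exceeds [M / e], the floor of [f w / e] lies between [-N] and [N], which leaves
   [2N + 1] grid points. *)
exists (undup [seq e * (Posz i - Posz N)%:~R | i <- iota 0 N.*2.+1]).
  exact: undup_uniq.
move=> w; rewrite mem_undup.
have M0 : 0 <= M / e by rewrite divr_ge0 ?(ltW e0)// (le_trans _ (fM w)).
have MN : M / e < N%:R by rewrite archi_boundP.
set k := Num.floor (f w / e).
have /ler_normlP[fl fu] := fM w.
have kN : k <= N.
  rewrite -(ler_int R); apply: le_trans (Num.Theory.floor_le _) _.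
  by apply: le_trans (ltW MN); rewrite ler_pM2r// invr_gt0.
have Nk : - Posz N <= k.
  rewrite /k Num.Theory.floor_ge_int rmorphN /= lerNl; apply: le_trans (ltW MN).
  by rewrite -mulNr ler_pM2r// invr_gt0.
apply/mapP; exists (absz (k + Posz N)).
  by rewrite mem_iota add0n /=; lia.
rewrite /round_to -/k; congr (_ * _%:~R); lia.
Qed.

End Rounding.

Lemma exists_maximal (d : Order.disp_t) (S : porderType d) (D : seq S) :
  D != [::] -> exists2 y, y \in D & forall x, x \in D -> ~ (y < x)%O.
Proof.
elim: D => // x D IHD _; have [->|/IHD[y yD ymax]] := eqVneq D [::].
  by exists x; [rewrite inE|move=> z; rewrite inE => /eqP ->; rewrite ltxx].
have [yx|nyx] := boolP (y < x)%O.
  exists x; first by rewrite inE eqxx.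
  move=> z; rewrite inE => /predU1P[->|/ymax nyz xz]; first by rewrite ltxx.
  by apply: nyz; exact: lt_trans xz.
exists y; first by rewrite inE yD orbT.
by move=> z; rewrite inE => /predU1P[->|/ymax//]; exact/negP.
Qed.

Lemma maxn_eq_gtr (m n i : nat) : (n < i)%N -> (maxn m n == i) = (m == i).
Proof. by move=> ni; apply/eqP/eqP; lia. Qed.

(** * Transport of dust by one kernel, and its iteration *)

Section Dust.
Context {d : Order.disp_t} {S : porderType d} {E : pointedType} {R : realType}.
Local Notation Omega := (S -> E).
Hypothesis countE : countable [set: E].
Variables (g : @kfamily d S E R) (alpha : S -> S -> R) (G : R).
Hypothesis proper1 : forall y, proper_oriented_kernel g [set y].
Hypothesis quasilocal1 : forall y A, F (~` future [set y]) A -> is_local A ->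
  quasilocal (fun w => fine (g [set y] w A)).
Hypothesis dusty : is_dust_rate g alpha.
Hypothesis G01 : 0 <= G < 1.
Hypothesis alpha_sum : forall y (t : seq S), uniq t ->
  (forall x, x \in t -> (x <= y)%O) -> \sum_(x <- t) alpha y x <= G.

(** A real upper bound in place of the extended supremum [osc]: only bounds on the dust are
    propagated. *)
Definition osc_le (x : S) (f : Omega -> R) (a : R) :=
  forall w w', eq_off x w w' -> `|f w - f w'| <= a.

Lemma osc_le_ge0 (x : S) (f : Omega -> R) (a : R) : osc_le x f a -> 0 <= a.
Proof.
by move=> /(_ (fun=> point) (fun=> point)); rewrite subrr normr0; apply.
Qed.

Lemma osc_le_notin (D : seq S) (f : Omega -> R) (x : S) :
  determined [set` D] f -> x \notin D -> osc_le x f 0.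
Proof.
move=> detf xD w w' ww'; rewrite (detf w w') ?subrr ?normr0// => z zD.
by apply: ww' => zx; move: xD; rewrite -zx zD.
Qed.

(** [alpha] cut off to the strict past of [y], so that its sums over arbitrary duplicate-free lists
    stay below [G]. *)
Definition dust (y x : S) : R := if (x < y)%O then alpha y x else 0.

Lemma dust_ge0 y x : 0 <= dust y x.
Proof.
by rewrite /dust; case: ifP => // xy; apply: dusty.1; exact: ltW.
Qed.

Lemma dust_sum y (t : seq S) : uniq t -> \sum_(x <- t) dust y x <= G.
Proof.
move=> ut; rewrite /dust -big_mkcond -big_filter; apply: alpha_sum.
  exact: filter_uniq.
by move=> x; rewrite mem_filter => /andP[/ltW].
Qed.

Section OneStep.
Variables (y : S) (D : seq S) (f : Omega -> R).
Hypothesis Dy : forall x, x \in D -> ~ (y < x)%O.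
Hypothesis detf : determined [set` D] f.
Hypothesis rf : finite_range f.

(** The term [a] is the direct effect of [x] on [f]; the other term is its effect through the
    kernel, which vanishes unless [x < y]. *)
Lemma gam_osc_le (x : S) (a b : R) : osc_le x f a -> osc_le y f b ->
  osc_le x (gam g y f) (a + dust y x * b).
Proof.
move=> fa fb w w' ww'; apply: (gam_osc countE (proper1 y) Dy detf rf ww') => //.
rewrite /dust; case: ifPn => [xlty|nxy]; last first.
  rewrite mul0r (gam_frozen_determined countE (proper1 y) w rf (w' := w')).
    by rewrite subrr normr0.
  move=> z [_ [_ -> zy]]; apply: ww' => zx; move: nxy; rewrite -zx.
  by rewrite zy.
pose h (s : Omega) := f (upd w y (s y)).
have deth : determined [set` [:: y]] h by exact: frozen_determined.
have mh : measurable_wrt [set y] h.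
  move=> B mB; apply: (determined_F countE (D := [:: y])).
    by move=> z /=; rewrite inE => /eqP.
  by move=> s s' ss'; rewrite /preimage /= (deth s s').
have bh : exists M : R, forall s, `|h s| <= M.
  have [l _ fl] := rf.
  by apply: (@finite_range_bounded _ (OmegaT setT) _ h l) => s; exact: fl.
have := dusty.2.2 y x h xlty mh bh.
have osch : (osc y h <= b%:E)%E.
  apply: ge_ereal_sup => _ [s [s' [ss' ->]]]; rewrite lee_fin; apply: fb => z zy.
  by rewrite /upd; case: eqP.
move=> H; rewrite -lee_fin mulrC EFinM.
apply: (@le_trans _ _ (osc x (gam g y h))).
  by apply: ereal_sup_ubound; exists w, w'.
apply: le_trans H _; apply: lee_wpmul2r => //.
by rewrite lee_fin; apply: dusty.1; exact: ltW.
Qed.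

(** Quasilocality allows all but finitely many coordinates to be reset to [point]; rounding then
    restores a finite range. The error per site is so small that its sum over [D'] stays below
    [e]. *)
Lemma local_approximation (a : S -> R) (e : R) : y \in D -> 0 < e ->
  (forall x, x \in D -> osc_le x f (a x)) ->
  exists (D' : seq S) (h : Omega -> R),
    [/\ uniq D', y \notin D', forall x, x \in D -> x != y -> x \in D',
        determined [set` D'] h /\ finite_range h &
        (forall x, x \in D' -> osc_le x h
          ((if x \in D then a x else 0) + dust y x * a y + e / (size D').+1%:R)) /\
        (forall w, `|gam g y f w - h w| <= e)].
Proof.
move=> yD e0 fa; have e2 : 0 < e / 2 by rewrite divr_gt0.
have [L [finL HL]] := gam_quasilocal countE Dy detf rf (quasilocal1 (y := y)) e2.
have [l Ll] := (finite_seqP L).1 finL.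
pose D' := undup [seq x <- D ++ l | x != y].
have inD' x : (x \in D') = (x != y) && ((x \in D) || (x \in l)).
  by rewrite mem_undup mem_filter mem_cat.
pose tr (w : Omega) : Omega := fun z => if z \in D' then w z else point.
(* A difference of two rounded values is off by at most [2 * r], the error allowed per site; the
   successor covers an empty [D']. *)
pose r := e / 2 / (size D').+1%:R.
have r0 : 0 < r by rewrite divr_gt0.
have [M fM] : exists M : R, forall w, `|f w| <= M.
  by have [s _ fs] := rf; exact: (@finite_range_bounded _ (OmegaT setT) _ f s).
exists D', (fun w => round_to r (gam g y f (tr w))); split.
- exact: undup_uniq.
- by rewrite inD' eqxx.
- by move=> x xD xy; rewrite inD' xy xD.
- split.
    move=> w w' ww'; congr (round_to r (gam g y f _)); apply/funext => z.
    by rewrite /tr; case: ifPn => // /ww'.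
  apply: (@finite_range_round _ _ _ _ r M (fun w => gam g y f (tr w))) => // w.
  exact: (gam_bounded countE g Dy detf rf fM).
- split.
    move=> x _ w w' ww'.
    have fb : osc_le x f (if x \in D then a x else 0).
      by case: ifPn => [/fa//|]; exact: osc_le_notin.
    have trww' : eq_off x (tr w) (tr w') by move=> z zx; rewrite /tr ww'.
    have H1 := gam_osc_le fb (fa y yD) trww'.
    have H2 := round_to_dist (gam g y f (tr w)) r0.
    have H3 := round_to_dist (gam g y f (tr w')) r0.
    have -> : e / (size D').+1%:R = r + r by rewrite /r -mulrDl -splitr.
    move: H1 H2 H3.
    set A := _ + dust y x * _; set u := gam g y f _; set v := gam g y f _.
    rewrite !ler_norml => /andP[? ?] /andP[? ?] /andP[? ?]; apply/andP; split; lra.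
  move=> w; have H2 := round_to_dist (gam g y f (tr w)) r0.
  have rle : r <= e / 2.
    by rewrite /r ler_pdivrMr// ler_peMr ?ler1n ?ltW.
  have H1 : `|gam g y f w - gam g y f (tr w)| <= e / 2.
    (* [tr] also resets the coordinate [y], which may belong to [L]. As [gam g y f] ignores it, it
       is put back before quasilocality is used. *)
    rewrite (gam_indep countE (proper1 y) Dy detf (w := tr w) (w' := upd (tr w) y (w y)) rf).
      apply/ltW/HL => z; rewrite Ll /= => zl; rewrite /upd /tr inD' zl orbT andbT.
      by case: eqP => // ->.
    by move=> z zy; rewrite /upd; case: eqP.
  move: H1 H2; rewrite !ler_norml => /andP[? ?] /andP[? ?]; apply/andP; split; lra.
Qed.

End OneStep.

(** * Comparison of two Gibbs measures on local functions *)

Section TwoGibbsMeasures.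
Variables mu nu : probability (@OmegaT d S E setT) R.
Hypotheses (gibbs_mu : in_Gibbs g mu) (gibbs_nu : in_Gibbs g nu).

Lemma Rintegral_gap_approx (f h : Omega -> R) (e : R) :
  mu.-integrable setT (EFin \o f) -> mu.-integrable setT (EFin \o h) ->
  nu.-integrable setT (EFin \o f) -> nu.-integrable setT (EFin \o h) ->
  (forall w, `|f w - h w| <= e) ->
  `|\int[mu]_w f w - \int[nu]_w f w| <= `|\int[mu]_w h w - \int[nu]_w h w| + 2 * e.
Proof.
move=> mf mh nf nh fh.
have := Rintegral_dist mf mh fh; have := Rintegral_dist nf nh fh.
set a := Rintegral _ _ _; set b := Rintegral _ _ _.
set a' := Rintegral _ _ _; set b' := Rintegral _ _ _ => H1 H2.
rewrite (_ : a' - a = (b' - b) + (a' - b') - (a - b)); last by ring.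
apply: le_trans (ler_normB _ _) _; apply: le_trans (lerD (ler_normD _ _) (lexx _)) _.
by lra.
Qed.

(** With [k x] moves left, dust at [x] can shrink by the factor [G ^+ k x] before it is dropped and
    paid for. *)
Definition gap_bound (D : seq S) (a : S -> R) (k : S -> nat) : R :=
  \sum_(x <- D) a x * G ^+ k x.

(** Dust leaving [y] loses a factor [G] in mass and one level, so its weighted amount does not grow.
    A site that has or receives dust gets level at least [j] and keeps at least its old level; as
    [G <= 1], its weight is at most [G ^+ j] and at most the old weight. *)
Lemma gap_bound_step (y : S) (D D' : seq S) (a a' : S -> R) (k : S -> nat)
    (j : nat) (e : R) : 0 < e ->
  uniq D -> uniq D' -> y \in D -> y \notin D' -> k y = j.+1 ->
  (forall x, x \in D -> x != y -> x \in D') ->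
  (forall x, x \in D -> 0 <= a x) ->
  (forall x, x \in D' -> a' x =
     (if x \in D then a x else 0) + dust y x * a y + e / (size D').+1%:R) ->
  gap_bound D' a' (fun x => if x \in D then maxn (k x) j else j) <=
  gap_bound D a k + e.
Proof.
move=> e0 uD uD' yD yD' ky DD' a0 a'E; have /andP[G0 /ltW G1] := G01.
set k' := fun x => if x \in D then maxn (k x) j else j.
have Gk' x : G ^+ k' x <= G ^+ j.
  apply: ler_wiXn2l => //; rewrite /k'; case: ifP => // _; exact: leq_maxr.
have ay := a0 y yD.
rewrite /gap_bound [in leRHS](bigD1_seq y)//= ky exprS.
(* Three contributions: dust already in place, dust received from [y], and approximation error. *)
apply: (@le_trans _ _ (\sum_(x <- D') ((if x \in D then a x * G ^+ k x else 0) +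
   dust y x * (a y * G ^+ j) + e / (size D').+1%:R))).
  rewrite big_seq [leRHS]big_seq; apply: ler_sum => x xD'; rewrite a'E// !mulrDl.
  apply: lerD; first apply: lerD.
  - rewrite /k'; case: ifPn => xD; last by rewrite mul0r.
    by rewrite ler_wpM2l ?a0// ler_wiXn2l// leq_maxl.
  - by rewrite -mulrA !ler_wpM2l// dust_ge0.
  - rewrite ler_piMr// ?exprn_ile1// divr_ge0//; exact: ltW.
rewrite !big_split /=; apply: lerD; first rewrite addrC; first apply: lerD.
- rewrite -mulr_suml [leRHS]mulrCA ler_wpM2r ?dust_sum//.
  by rewrite mulr_ge0 ?exprn_ge0.
- rewrite -big_mkcond -big_filter -[leRHS]big_filter (perm_big [seq x <- D | x != y])//.
  apply: uniq_perm; rewrite ?filter_uniq// => x; rewrite !mem_filter andbC.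
  apply/andP/andP => -[H1 H2]; split=> //.
  + by apply: contraNneq yD' => <-.
  + exact: DD'.
- rewrite big_const_seq count_predT iter_addr_0 -[leLHS]mulr_natr -mulrA ler_piMr ?(ltW e0)//.
  by rewrite mulrC ler_pdivrMr// mul1r ler_nat.
Qed.

(* [k x] is the number of times that dust at [x] still has to be redistributed.
   Handling a maximal site [y] only creates or modifies sites of level below [k y],
   so the vector of numbers of sites per level decreases lexicographically. *)
Lemma gap_estimate (K : nat) (st : seq S * (S -> nat)) : uniq st.1 ->
  (forall x, st.2 x < K)%N ->
  forall (f : Omega -> R) (a : S -> R), determined [set` st.1] f -> finite_range f ->
  (forall x, x \in st.1 -> osc_le x f (a x)) ->
  `|\int[mu]_w f w - \int[nu]_w f w| <= 2 * gap_bound st.1 a st.2.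
Proof.
pose c (st : seq S * (S -> nat)) i := count (fun x => st.2 x == i) st.1.
move: st; apply: (@lexicographic_ind _ c K) => -[D k] IH /= uD kK f a detf rf fa.
have loc_int (P : probability (OmegaT setT) R) (t : seq S) (h : Omega -> R) :
    determined [set` t] h -> finite_range h -> P.-integrable setT (EFin \o h).
  exact: local_integrable.
have [D0|/exists_maximal[y yD ymax]] := eqVneq D [::].
  have -> : f = fun=> f (fun=> point).
    by apply/funext => w; apply: detf => z; rewrite D0.
  by rewrite !Rintegral_probability_cst subrr normr0 /gap_bound D0 big_nil mulr0.
have a0 x : x \in D -> 0 <= a x by move/fa/osc_le_ge0.
have cnt_rem i : count (fun x => k x == i) [seq x <- D | x != y] =
    (count (fun x => k x == i) D - (k y == i))%N.
  by rewrite -rem_filter// count_rem yD.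
have cnt_pos i : k y = i -> (0 < count (fun x => k x == i) D)%N.
  by move=> kyi; rewrite -has_count; apply/hasP; exists y => //; exact/eqP.
case ky : (k y) => [|j].
  (* At level 0 the dust at [y] is dropped: setting the coordinate [y] to [point] moves each of the
     two integrals by at most [a y], which pays exactly the term of [y] in the bound. *)
  pose h (w : Omega) := f (upd w y point).
  have deth : determined [set` [seq x <- D | x != y]] h.
    move=> w w' ww'; apply: detf => z zD; rewrite /upd; case: eqP => // /eqP zy.
    by apply: ww'; rewrite /= mem_filter zy.
  have rh : finite_range h by have [s us fs] := rf; exists s => // w; exact: fs.
  have IHh := IH ([seq x <- D | x != y], k) 0%N.
  apply: le_trans (@Rintegral_gap_approx f h (a y) _ _ _ _ _) _.
  - exact: (loc_int _ _ _ detf).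
  - exact: (loc_int _ _ _ deth).
  - exact: (loc_int _ _ _ detf).
  - exact: (loc_int _ _ _ deth).
  - by move=> w; apply: fa => // z zy; rewrite /upd; case: eqP.
  rewrite /gap_bound (bigD1_seq y)//= ky expr0 mulr1 mulrDr [leRHS]addrC lerD2r.
  rewrite -big_filter; apply: IHh => //=.
  - by apply: leq_ltn_trans (kK y).
  - by rewrite /c /= cnt_rem ky eqxx subn1 ltn_predL cnt_pos.
  - by move=> i /andP[i0 _]; rewrite /c /= cnt_rem ky; case: i i0 => // i _; rewrite subn0.
  - exact: filter_uniq.
  - move=> x; rewrite mem_filter => /andP[_ xD] w w' ww'; apply: fa => // z zx.
    by rewrite /upd; case: eqP => // _; exact: ww'.
(* An approximation within [e / 4] costs [2 * (e / 4)] in the integrals and as much again in twice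
   the bound. *)
apply/ler_addgt0Pr => e e0.
have e4 : 0 < e / 4 by rewrite divr_gt0.
have [D' [h [uD' yD' DD' [deth rh] [osch gamh]]]] :=
  local_approximation ymax detf rf yD e4 fa.
have [imu Emu] := gibbs_gam countE (proper1 y) ymax detf gibbs_mu rf.
have [inu Enu] := gibbs_gam countE (proper1 y) ymax detf gibbs_nu rf.
rewrite -Emu -Enu.
apply: le_trans (@Rintegral_gap_approx _ h (e / 4) _ _ _ _ gamh) _ => //.
- exact: (loc_int _ _ _ deth).
- exact: (loc_int _ _ _ deth).
pose k' x := if x \in D then maxn (k x) j else j.
pose a' x := (if x \in D then a x else 0) + dust y x * a y + e / 4 / (size D').+1%:R.
have step : gap_bound D' a' k' <= gap_bound D a k + e / 4.
  exact: (gap_bound_step (y := y)).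
(* Above level [j] only the site [y] is lost: new sites enter at level [j], and [maxn] lifts old
   ones no higher than [j]. Hence the count at level [j.+1] drops. *)
have cnt' i : (j < i)%N -> count (fun x => k' x == i) D' =
    count (fun x => k x == i) [seq x <- D | x != y].
  move=> ji; rewrite -!size_filter; apply: perm_size.
  apply: uniq_perm; rewrite ?filter_uniq// => x; rewrite !mem_filter /k'.
  have [xD|xD] := boolP (x \in D); last by rewrite (ltn_eqF ji) !andbF.
  rewrite andbT maxn_eq_gtr//.
  case: eqP => //= _; apply/idP/idP => [xD'|xy]; last exact: DD'.
  by apply: contraNneq yD' => <-.
have kyK := kK y; rewrite ky in kyK.
have := IH (D', k') j.+1 kyK; rewrite /c /= => IHh.
have {IHh} : `|\int[mu]_w h w - \int[nu]_w h w| <= 2 * gap_bound D' a' k'.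
  apply: IHh => //.
  - by rewrite cnt'// cnt_rem ky eqxx subn1 ltn_predL cnt_pos.
  - by move=> i /andP[ji _]; rewrite cnt' 1?ltnW// cnt_rem ky (ltn_eqF ji) subn0.
  - by move=> x; rewrite /k' (fun_if (fun n => n < K)%N) gtn_max kK (ltnW kyK) if_same.
by move: step; lra.
Qed.

End TwoGibbsMeasures.
End Dust.

(** * Passage to the limit, and from local events to all events *)

Lemma le0_geometric {R : realType} (x C q : R) : 0 <= q < 1 ->
  (forall n, x <= C * q ^+ n) -> x <= 0.
Proof.
move=> /andP[q0 q1] xC; apply/ler_addgt0Pr => e e0; rewrite add0r.
have normq : `|q| < 1 by rewrite ger0_norm.
have /cvgrPdist_lt/(_ e e0)[N _ /(_ N (leqnn N))] := cvg_geometric C normq.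
rewrite /= sub0r normrN => /ltW; apply: le_trans.
exact: le_trans (xC N) (ler_norm _).
Qed.

Lemma dust_Gamma_sum {d : Order.disp_t} {S : porderType d} {R : realType}
    (alpha : S -> S -> R) (y : S) (t : seq S) : uniq t ->
  (forall x, x \in t -> (x <= y)%O) ->
  ((\sum_(x <- t) alpha y x)%:E <= dust_Gamma alpha)%E.
Proof.
move=> ut ty; apply: (@le_trans _ _ (\esum_(x in [set x | (x <= y)%O]) (alpha y x)%:E)%E).
  apply: esum_ge; exists [set` t].
    by split; [exact: finite_seq|exact: ty].
  by rewrite -fsbig_seq// sumEFin.
by apply: ereal_sup_ubound; exists y.
Qed.

Section Uniqueness.
Context {d : Order.disp_t} {S : porderType d} {E : pointedType} {R : realType}.
Hypothesis countE : countable [set: E].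

(** Events determined by finitely many sites are stable under intersection and generate [F setT], so
    a probability is fixed by its values on them. *)
Lemma cylinder_unique (mu nu : probability (@OmegaT d S E setT) R) :
  (forall (D : seq S) A, determined [set` D] A -> mu A = nu A) ->
  forall A, F setT A -> mu A = nu A.
Proof.
move=> mn A FA.
pose C : set (set (S -> E)) := [set A | exists D : seq S, determined [set` D] A].
have FC : C `<=` F setT by move=> B [D detB]; exact: (determined_F countE _ detB).
apply: (@measure_unique _ R (OmegaT setT) C (fun=> setT)) => //.
- apply/seteqP; split.
    apply: sub_sigma_algebra2 => B [x [e [_ ->]]].
    by exists [:: x] => w w' ww'; rewrite /preimage /= ww'//= inE.
  by apply: smallest_sub => //; exact: sigma_algebra_measurable.
- move=> B1 B2 [D1 det1] [D2 det2]; exists (D1 ++ D2) => w w' ww'.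
  rewrite /setI /= (det1 w w') ?(det2 w w')// => z zD; apply: ww';
    by rewrite /= mem_cat zD ?orbT.
- by move=> _; exists [::].
- by rewrite bigcup_const.
- by move=> B [D detB]; exact: mn detB.
- by move=> k; apply: (le_lt_trans (probability_le1 mu (@measurableT _ _))); rewrite ltry.
Qed.
End Uniqueness.

Theorem mainTheorem12 (d : Order.disp_t) (S : porderType d) (E : pointedType)
  (R : realType) (g : @kfamily d S E R) :
  @standing_assumptions d S ->
  countable [set: E] ->
  quasilocal_POS g ->
  (exists alpha : S -> S -> R, is_dust_rate g alpha /\ (dust_Gamma alpha < 1)%E) ->
  forall mu nu : probability (@OmegaT d S E setT) R,
    in_Gibbs g mu -> in_Gibbs g nu ->
    forall A : set (S -> E), F setT A -> mu A = nu A.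
Proof.
move=> _ countE [[proper _] ql] [alpha [dusty Gamma1]] mu nu gmu gnu.
apply: (cylinder_unique countE) => D0 B detB.
pose A : set (S -> E) := B.
pose D := undup D0.
have detA : determined [set` D] A.
  by apply: sub_determined detB => z /=; rewrite mem_undup.
(* The maximum with 0 yields a real number in [[0, 1)] even for an empty [S], where the supremum is
   [-oo]. *)
pose G := fine (maxe 0%E (dust_Gamma alpha)).
have GE : G%:E = maxe 0%E (dust_Gamma alpha).
  by rewrite fineK// ge0_fin_numE ?le_max ?lexx// gt_max ltry (lt_trans Gamma1) ?ltry.
have G01 : 0 <= G < 1.
  by rewrite -lee_fin -lte_fin GE le_max lexx /= gt_max Gamma1 lte01.
have alpha_sum y (t : seq S) : uniq t -> (forall x, x \in t -> (x <= y)%O) ->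
    \sum_(x <- t) alpha y x <= G.
  by move=> ut ty; rewrite -lee_fin GE le_max dust_Gamma_sum ?orbT.
have FA U : [set` D] `<=` U -> F U A by move/determined_F; apply.
have intA (P : probability (OmegaT setT) R) :
    \int[P]_w (\1_A w : R) = fine (P A).
  by rewrite /Rintegral integral_indic ?setIT//; exact: FA.
(* Every site of [D] starts at level [n] with dust 1, which bounds the oscillation of an indicator;
   levels must lie strictly below [K], whence [n.+1]. *)
have gap n : `|fine (mu A) - fine (nu A)| <= 2 * (size D)%:R * G ^+ n.
  have := gap_estimate countE (fun y => proper _ (time_box1 y))
    (fun y C => ql _ C (time_box1 y)) dusty G01 alpha_sum gmu gnu
    (K := n.+1) (st := (D, fun=> n)) (undup_uniq _) (fun=> ltnSn n)
    (f := \1_A) (a := fun=> 1).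
  rewrite !intA /gap_bound /= big_const_seq count_predT iter_addr_0 mul1r.
  rewrite -[X in 2 * X]mulr_natl mulrA; apply.
  - by move=> w w' ww'; rewrite !indicE (_ : (w \in A) = (w' \in A))//;
      apply/idP/idP; rewrite !inE (detA _ _ ww').
  - exists [:: 0; 1]; first by rewrite /= inE eq_sym oner_eq0.
    by move=> w; rewrite indicE !inE; case: (w \in A); rewrite eqxx ?orbT.
  - move=> x _ w w' _; rewrite !indicE; case: (w \in A); case: (w' \in A);
      by rewrite /= ?subrr ?subr0 ?sub0r ?normrN ?normr0 ?normr1.
have := le0_geometric G01 gap; rewrite normr_le0 subr_eq0 => /eqP mnA.
have finA (P : probability (OmegaT setT) R) : P A \is a fin_num.
  by apply: fin_num_measure; exact: FA.
by rewrite -[LHS](fineK (finA mu)) -[RHS](fineK (finA nu)) mnA.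
Qed.
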